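(* For every $\varepsilon>0$ there exists $n_0(\varepsilon)\in\mathbb{N}$ such that for all $n\ge n_0(\varepsilon)$, every $2$-colouring of $[2,n]$ contains at least $n^{1/3-\varepsilon}$ monochromatic product Schur triples.
   Context: $[2,n]=\{2,3,\dots,n\}$. A product Schur triple in $[2,n]$ is a triple of integers $a,b,c\in[2,n]$ (not necessarily distinct) with $ab=c$; it is monochromatic if $a,b,c$ all receive the same colour. *)

(* Defs.v *)
From mathcomp Require Import all_boot all_order all_algebra.

Set Implicit Arguments.
Unset Strict Implicit.
Unset Printing Implicit Defensive.

Definition int2 (n : nat) : {set 'I_n.+1} := [set m : 'I_n.+1 | 2 <= m].

(* Triples are ordered: (a, b, c) and (b, a, c) differ if a <> b; the product a * b is taken in
   nat. *)
Definition product_schur (n : nat) (t : 'I_n.+1 * 'I_n.+1 * 'I_n.+1) : bool :=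
  let: (a, b, c) := t in
  [&& a \in int2 n, b \in int2 n, c \in int2 n
    & (a : nat) * (b : nat) == (c : nat)].

(* A 2-colouring of [2, n] is represented by a total function nat -> bool; only
   its values on [2, n] are used by mono_product_schur n. *)
Definition monochromatic (chi : nat -> bool) (n : nat)
    (t : 'I_n.+1 * 'I_n.+1 * 'I_n.+1) : bool :=
  let: (a, b, c) := t in (chi a == chi b) && (chi b == chi c).

Definition mono_product_schur (n : nat) (chi : nat -> bool) :
    {set 'I_n.+1 * 'I_n.+1 * 'I_n.+1} :=
  [set t | product_schur t && monochromatic chi t].

(* Main.v *)
(** For every a, two of a, 2a, 4a get the same colour; call them u and ru, where
    r is 2 or 4.  Whatever the colours of r, u^2 and ru^2 are, one of (r, u),
    (u, u), (u, ru), (r, u^2) together with its product is monochromatic.  The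
    product is 2^k a or 2^k a^2 with k <= 3, so a triple arises from at most 8
    values of a, and a may range up to a constant times n^(1/2).  This gives the
    stronger order of magnitude n^(1/2). *)
Require Import Defs.
From mathcomp Require Import all_boot all_order all_algebra.
From mathcomp Require Import reals exp.
From mathcomp Require Import zify.
Import Order.TTheory GRing.Theory Num.Theory.

Lemma mono_product_of_dilation {chi : nat -> bool} {r u : nat} :
  chi u = chi (r * u) ->
  exists b c, [/\ chi b = chi c, chi c = chi (b * c)
    & (b, c) \in [:: (r, u); (u, u); (u, r * u); (r, u * u)]].
Proof.
move=> Eu.
have [Eru|Nru] := eqVneq (chi r) (chi u).
  by exists r, u; rewrite Eru -Eu inE eqxx.
have [Euu|Nuu] := eqVneq (chi u) (chi (u * u)).
  by exists u, u; rewrite -Euu !inE eqxx orbT.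
have [Eruu|Nruu] := eqVneq (chi u) (chi (u * (r * u))).
  by exists u, (r * u); rewrite -Eruu -Eu !inE eqxx !orbT.
(* Here [r], [u * u] and [r * (u * u)] all have the colour opposite to that of [u], so they
   agree. *)
exists r, (u * u); rewrite !inE eqxx !orbT [r * _]mulnCA; split=> //;
  by move: Nru Nuu Nruu;
    case: (chi r) (chi u) (chi (u * u)) (chi (u * (r * u))) => [] [] [] [].
Qed.

(** Pigeonhole on [a], [2 * a], [4 * a]. The bounds on [s] and [l] yield [l + 2 * s <= 3], which
    caps the power of 2 in the final product. *)
Lemma same_colour_dilates (chi : nat -> bool) (a : nat) :
  exists s l, [/\ 0 < l, s + l <= 2, s <= 1
    & chi (2 ^ s * a) = chi (2 ^ l * (2 ^ s * a))].
Proof.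
have [E1|N1] := eqVneq (chi a) (chi (2 * a)).
  by exists 0, 1; rewrite mul1n.
have [E2|N2] := eqVneq (chi a) (chi (4 * a)).
  by exists 0, 2; rewrite mul1n.
exists 1, 1; rewrite !expn1 mulnA; split=> //.
by move: N1 N2; case: (chi a) (chi (2 * a)) (chi (4 * a)) => [] [] [].
Qed.

Lemma mono_product_over (chi : nat -> bool) {a : nat} : 1 < a ->
  exists b c k (e : bool), [/\ 1 < b, 1 < c, k <= 3, b * c = 2 ^ k * a ^ e.+1
    & chi b = chi c /\ chi c = chi (b * c)].
Proof.
move=> a_gt1.
have [s [l [l_gt0 sl_le s_le Eu]]] := same_colour_dilates chi a.
have r_gt1 : 1 < 2 ^ l by rewrite -{1}(expn0 2) ltn_exp2l.
have u_gt1 : 1 < 2 ^ s * a by rewrite (leq_trans a_gt1) ?leq_pmull ?expn_gt0.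
have [b [c [Ebc Ec bc_in]]] := mono_product_of_dilation Eu.
have [k [e [k_le Ek b_gt1 c_gt1]]] : exists k (e : bool),
    [/\ k <= 3, b * c = 2 ^ k * a ^ e.+1, 1 < b & 1 < c].
  have gt1M x y : 1 < x -> 1 < y -> 1 < x * y by nia.
  (* With [r = 2 ^ l] and [u = 2 ^ s * a], the four products carry the exponents [l + s], [2 * s],
     [l + 2 * s], [l + 2 * s] of 2; only the first is linear in [a]. *)
  move: bc_in; rewrite !inE !xpair_eqE => /or4P[] /andP[/eqP-> /eqP->].
  - by exists (l + s), false; rewrite r_gt1 u_gt1 expnD mulnA; split=> //; lia.
  - by exists (s + s), true; rewrite u_gt1 mulnACA -expnD mulnn; split=> //; lia.
  - exists (s + (l + s)), true.
    by rewrite u_gt1 gt1M // [2 ^ l * _]mulnA mulnACA -!expnD mulnn; split=> //; lia.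
  - exists (l + (s + s)), true.
    by rewrite r_gt1 gt1M // mulnACA mulnA -!expnD mulnn; split=> //; lia.
by exists b, c, k, e.
Qed.

Lemma mono_product_schur_lower_bound (chi : nat -> bool) (n m : nat) :
  8 * m.+1 ^ 2 <= n -> m <= 8 * #|mono_product_schur n chi|.
Proof.
move=> m_small; set S := mono_product_schur n chi.
(* The base is [a = i.+2], so [2 <= a <= m.+1]. Recording [(k, e)] next to the triple makes the
   choice injective: [b * c = 2 ^ k * a ^ e.+1] then determines [a]. *)
have /fin_all_exists[f fP] (i : 'I_m) :
    exists y : 'I_n.+1 * 'I_n.+1 * 'I_n.+1 * ('I_4 * bool),
    y.1 \in S /\ y.1.2 = 2 ^ y.2.1 * i.+2 ^ y.2.2.+1 :> nat.
  have [b [c [k [e [b_gt1 c_gt1 k_le Ek [Ebc Ec]]]]]] :=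
    mono_product_over chi (isT : 1 < i.+2).
  have bc_le : b * c <= n.
    rewrite Ek (leq_trans _ m_small) //; apply: leq_mul.
      by rewrite -[8]/(2 ^ 3) leq_exp2l.
    apply: (@leq_trans (i.+2 ^ 2)); first by rewrite leq_exp2l //; case: (e).
    by rewrite leq_exp2r // ltnS ltn_ord.
  have b_lt : b < n.+1 by rewrite ltnS (leq_trans _ bc_le) // leq_pmulr // ltnW.
  have c_lt : c < n.+1 by rewrite ltnS (leq_trans _ bc_le) // leq_pmull // ltnW.
  have bc_lt : b * c < n.+1 by [].
  exists (Ordinal b_lt, Ordinal c_lt, Ordinal bc_lt, (@Ordinal 4 k k_le, e)).
  split=> //; rewrite inE /= !inE /= Ebc Ec !eqxx b_gt1 c_gt1 /= !andbT.
  by rewrite (leq_trans b_gt1) // leq_pmulr // ltnW.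
have f_inj : injective f.
  move=> i j Eij; apply: val_inj => /=.
  have [_ Ei] := fP i; have [_ Ej] := fP j.
  move/eqP: Ei; rewrite Eij Ej eqn_pmul2l ?expn_gt0 // eqn_exp2r //.
  by move/eqP => [].
rewrite -{1}(card_ord m) -(card_imset _ f_inj).
have <- : #|setX S [set: 'I_4 * bool]| = 8 * #|S|.
  by rewrite cardsX cardsT card_prod card_ord card_bool mulnC.
by apply/subset_leq_card/subsetP => _ /imsetP[i _ ->]; rewrite inE in_setT andbT; case: (fP i).
Qed.

(** If [s ^ 3 < n], the quadratic bound [n <= 800 * s ^ 2] gives [n ^ 3 <= 800 ^ 3 * s ^ 6 < 800 ^ 3
    * n ^ 2], hence [n < 800 ^ 3]. *)
Lemma leq_cube_mono_product_schur (chi : nat -> bool) (n : nat) :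
  800 ^ 3 <= n -> n <= #|mono_product_schur n chi| ^ 3.
Proof.
move=> n_large; rewrite leqNgt; apply/negP; set s := #|_| => s3_lt.
have n_lt : n < 8 * (8 * s + 2) ^ 2.
  rewrite ltnNge; apply/negP => n_ge.
  have := @mono_product_schur_lower_bound chi n (8 * s).+1.
  by rewrite -/s -[(8 * s).+2]addn2 ltnn => /(_ n_ge).
have n_gt0 : 0 < n by apply: leq_trans n_large; rewrite expn_gt0.
(* For [s > 0], [8 * s + 2 <= 10 * s], whence [800 = 8 * 10 ^ 2]; [s = 0] would force [n < 32]. *)
have n_le : n <= 800 * s ^ 2.
  have [s0|] := posnP s; last by nia.
  by move: n_lt n_large; rewrite s0; lia.
have : n ^ 3 < 800 ^ 3 * n ^ 2.
  rewrite (@leq_ltn_trans ((800 * s ^ 2) ^ 3)) ?leq_exp2r // expnMn -expnM.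
  by rewrite [2 * 3]mulnC expnM ltn_pmul2l ?expn_gt0 // ltn_exp2r.
by rewrite expnS ltn_pmul2r ?expn_gt0 ?n_gt0 // ltnNge n_large.
Qed.

Local Open Scope ring_scope.

Theorem theorem1p2 (R : realType) (eps : R) (eps_gt0 : 0 < eps) :
  exists n0 : nat, forall n : nat, (n0 <= n)%N ->
    forall chi : nat -> bool,
      n%:R `^ (1 / 3 - eps) <= (#|mono_product_schur n chi|%:R : R).
Proof.
exists (800 ^ 3)%N => n n_large chi.
have n_gt0 : (0 < n)%N by apply: leq_trans n_large; rewrite expn_gt0.
set s := #|_|%N.
have n_le : n%:R <= s%:R ^+ 3 :> R.
  by rewrite -natrX ler_nat leq_cube_mono_product_schur.
(* Since [n >= 1], lowering the exponent by [eps] cannot increase the power. *)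
apply: (@le_trans _ _ (n%:R `^ (1 / 3))).
  by apply: ler_powR; rewrite ?ler1n // gerBl ltW.
have -> : s%:R = (s%:R ^+ 3) `^ (1 / 3) :> R.
  by rewrite -powR_mulrn // -powRrM mul1r divff ?pnatr_eq0 // powRr1.
by apply: ge0_ler_powR; rewrite ?nnegrE ?exprn_ge0 ?divr_ge0.
Qed.
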